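(* In the memoryless model, Best Policy can be solved exactly in $O(n^2)$ time and space, where $n$ is the number of vertices of the underlying graph; more precisely, the values $h(v,y)$ for all vertices $v$ can be computed in $O(n^2)$ time and space.
   Context: A memoryless stochastic temporal graph on $G=(V,E)$ ($n=|V|$) with probabilities $\{p_e\}$ is the random sequence of snapshots $G_t=(V,E_t)$, $t=1,2,\ldots$, where each edge $e$ belongs to $E_t$ with probability $p_e$, independently over all edges and time steps. Best Policy: Alice starts at vertex $s$ at time $0$ ($s_0=s$). At each step $t\geq 0$, once snapshot $G_{t+1}$ is revealed, knowing her current position, the snapshots observed so far, and the parameters of the model, she chooses $s_{t+1}$ to be either $s_t$ or a neighbour of $s_t$ in $G_{t+1}$. A policy is a rule making these choices; the arrival time is the first $t$ with $s_t=y$. $Y(s,y)$ is the arrival time under a policy minimizing the expected arrival time, and $h(s,y)=\mathbb{E}[Y(s,y)]$; the problem Best Policy is to compute $h(s,y)$ for given distinct $s,y$. The paper assumes (to avoid trivialities) that the graph formed by the edges with nonzero probability is connected. *)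

(* Defs.v *)
From HB Require Import structures.
From mathcomp Require Import all_boot all_order all_algebra finmap.
From mathcomp Require Import all_classical all_reals all_analysis.

Set Implicit Arguments.
Unset Strict Implicit.
Unset Printing Implicit Defensive.

Import Order.TTheory GRing.Theory Num.Theory.
Local Open Scope classical_set_scope.
Local Open Scope ring_scope.

(* The vertex set is 'I_n; an edge is an unordered pair [set u; v]. *)
Definition vedge (n : nat) := {set 'I_n}.
Definition snapshot (n : nat) := {set vedge n}.

Definition simple_graph (n : nat) (E : snapshot n) : Prop :=
  forall e, e \in E -> #|e| = 2%N.

(* [p] is only meaningful on the edges of the underlying graph. *)
Definition edge_probabilities (R : realType) (n : nat) (E : snapshot n)
    (p : vedge n -> R) : Prop :=
  forall e, e \in E -> 0 <= p e <= 1.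

Definition support_connected (R : realType) (n : nat) (E : snapshot n)
    (p : vedge n -> R) : Prop :=
  forall u v : 'I_n,
    connect (fun a b => ([set a; b]%SET \in E) && (0 < p [set a; b]%SET)) u v.

Definition mutually_independent d (T : measurableType d) (R : realType)
    (P : probability T R) (I : choiceType) (D : set I) (A : I -> set T) : Prop :=
  forall J : {fset I}, [set` J] `<=` D ->
    P (\bigcap_(i in [set` J]) A i) = (\prod_(i <- J) P (A i))%E.

(* [G t] is the snapshot revealed at time t = 1, 2, ...; [G 0] is not used. *)
Definition memoryless d (T : measurableType d) (R : realType)
    (P : probability T R) (n : nat) (E : snapshot n) (p : vedge n -> R)
    (G : nat -> T -> snapshot n) : Prop :=
  [/\ forall t w, (0 < t)%N -> G t w \subset E,
      forall t e, (0 < t)%N -> e \in E ->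
        measurable [set w | e \in G t w] /\
        P [set w | e \in G t w] = (p e)%:E
    & mutually_independent P
        [set te : nat * vedge n | (0 < te.1)%N /\ te.2 \in E]
        (fun te => [set w | te.2 \in G te.1 w])].

(* [pi past g v] is the next position when the earlier snapshots were [past]
   (oldest first), [g] has just been revealed and the current position is [v].
   Past positions are determined by the starting vertex and [past]. *)
Definition policy (n : nat) := seq (snapshot n) -> snapshot n -> 'I_n -> 'I_n.

Definition feasible (n : nat) (pi : policy n) : Prop :=
  forall past g v, pi past g v = v \/ [set v; pi past g v]%SET \in g.

Fixpoint walk (n : nat) (T : Type) (pi : policy n) (G : nat -> T -> snapshot n)
    (s : 'I_n) (w : T) (t : nat) : 'I_n :=
  if t is t'.+1 then
    pi [seq G i w | i <- iota 1%N t'] (G t w) (walk pi G s w t')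
  else s.

(* The first time at which [x] is at [y], +oo if there is none. *)
Definition arrival_time (R : realType) (n : nat) (x : nat -> 'I_n) (y : 'I_n)
    : \bar R :=
  ereal_inf [set (t%:R)%:E | t in [set t : nat | x t = y]].

Definition expected_arrival d (T : measurableType d) (R : realType)
    (P : probability T R) (n : nat) (G : nat -> T -> snapshot n)
    (pi : policy n) (s y : 'I_n) : \bar R :=
  (\int[P]_w arrival_time R (walk pi G s w) y)%E.

Definition optimal_policy d (T : measurableType d) (R : realType)
    (P : probability T R) (n : nat) (G : nat -> T -> snapshot n)
    (s y : 'I_n) (pi : policy n) : Prop :=
  feasible pi /\
  forall pi', feasible pi' ->
    (expected_arrival P G pi s y <= expected_arrival P G pi' s y)%E.

(* h(s, y) = h. *)
Definition best_policy_value d (T : measurableType d) (R : realType)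
    (P : probability T R) (n : nat) (G : nat -> T -> snapshot n)
    (s y : 'I_n) (h : R) : Prop :=
  exists pi, optimal_policy P G s y pi /\ expected_arrival P G pi s y = h%:E.

(* A program uses finitely many integer registers, finitely many real
   registers, and a memory of [N] cells, each holding one real number and
   addressed by integer registers.  Every instruction and every test costs one
   time unit.  Integer registers are words: an assignment of a value >= [N]
   faults, so unit-cost integer arithmetic is limited to numbers of the
   magnitude of an address.  Constants are natural numbers, there is no
   conversion from reals to integers, and division by zero faults. *)
Inductive instr : Type :=
  | ISet of nat & nat            (* i_x := k *)
  | IAdd of nat & nat & nat      (* i_x := i_y + i_z *)
  | ISub of nat & nat & nat      (* i_x := i_y - i_z, truncated *)
  | IMul of nat & nat & nat      (* i_x := i_y * i_z *)
  | RSet of nat & nat            (* r_a := k *)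
  | RAdd of nat & nat & nat      (* r_a := r_b + r_c *)
  | RSub of nat & nat & nat
  | RMul of nat & nat & nat
  | RDiv of nat & nat & nat
  | Read of nat & nat            (* r_a := cell i_x *)
  | Write of nat & nat.          (* cell i_x := r_a, for Write x a *)

Inductive test : Type :=
  | ILt of nat & nat             (* i_x < i_y *)
  | RLt of nat & nat.            (* r_a < r_b *)

Inductive cmd : Type :=
  | Do of instr
  | Seq of cmd & cmd
  | If of test & cmd & cmd
  | While of test & cmd.

Record state (R : realType) : Type := State {
  ireg : nat -> nat;
  rreg : nat -> R;
  cell : nat -> R }.

Section RealRAM.
Variables (R : realType) (N : nat).
Implicit Type s : state R.

Definition set_ireg s (x k : nat) : option (state R) :=
  if (k < N)%N then Some (State [eta ireg s with x |-> k] (rreg s) (cell s))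
  else None.

Definition set_rreg s (a : nat) (r : R) : option (state R) :=
  Some (State (ireg s) [eta rreg s with a |-> r] (cell s)).

Definition step (i : instr) s : option (state R) :=
  match i with
  | ISet x k => set_ireg s x k
  | IAdd x y z => set_ireg s x (ireg s y + ireg s z)%N
  | ISub x y z => set_ireg s x (ireg s y - ireg s z)%N
  | IMul x y z => set_ireg s x (ireg s y * ireg s z)%N
  | RSet a k => set_rreg s a k%:R
  | RAdd a b c => set_rreg s a (rreg s b + rreg s c)
  | RSub a b c => set_rreg s a (rreg s b - rreg s c)
  | RMul a b c => set_rreg s a (rreg s b * rreg s c)
  | RDiv a b c =>
      if rreg s c == 0 then None else set_rreg s a (rreg s b / rreg s c)
  | Read a x =>
      if (ireg s x < N)%N then set_rreg s a (cell s (ireg s x)) else None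
  | Write x a =>
      if (ireg s x < N)%N then
        Some (State (ireg s) (rreg s) [eta cell s with ireg s x |-> rreg s a])
      else None
  end.

Definition holds (b : test) s : bool :=
  match b with
  | ILt x y => (ireg s x < ireg s y)%N
  | RLt a b => rreg s a < rreg s b
  end.

(* [exec c s t s']: on a machine with [N] memory cells, [c] started in [s]
   halts without fault in [s'] after exactly [t] time units.  The relation is
   deterministic. *)
Inductive exec : cmd -> state R -> nat -> state R -> Prop :=
  | exec_do i s s' : step i s = Some s' -> exec (Do i) s 1%N s'
  | exec_seq c1 c2 s s1 s2 t1 t2 :
      exec c1 s t1 s1 -> exec c2 s1 t2 s2 ->
      exec (Seq c1 c2) s (t1 + t2)%N s2
  | exec_if b c1 c2 s s' t :
      exec (if holds b s then c1 else c2) s t s' ->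
      exec (If b c1 c2) s t.+1 s'
  | exec_while_end b c s : holds b s = false -> exec (While b c) s 1%N s
  | exec_while_loop b c s s1 s2 t1 t2 :
      holds b s -> exec c s t1 s1 -> exec (While b c) s1 t2 s2 ->
      exec (While b c) s (t1 + t2)%N.+1 s2.

End RealRAM.

(* Input: n and y in the integer registers 0 and 1, and the symmetric n x n
   matrix of edge probabilities (0 for non-edges) row by row in the cells
   0, ..., n^2 - 1.  The remaining registers and cells are arbitrary. *)
Definition encodes_input (R : realType) (n : nat) (E : snapshot n)
    (p : vedge n -> R) (y : 'I_n) (s : state R) : Prop :=
  [/\ ireg s 0%N = n,
      ireg s 1%N = y
    & forall u v : 'I_n, cell s (u * n + v)%N =
        if [set u; v]%SET \in E then p [set u; v]%SET else 0].

(* The n output cells are those that follow the input matrix. *)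
Definition output (R : realType) (n : nat) (s : state R) (v : 'I_n) : R :=
  cell s (n * n + v)%N.

(* Main.v *)
(* An optimal traveller at v moves to the open neighbour of least h, or waits if
   every open neighbour has larger h.  Hence, if v_0 = y, v_1, v_2, ... are the
   vertices by nondecreasing h, then h(v_k) is determined by its predecessors:
   with q_i the probability of the edge {v_k, v_i},
     h(v_k) = 1 + sum_(i < k) prod_(j < i) (1 - q_j) q_i h(v_i)
                + prod_(j < k) (1 - q_j) h(v_k),
   so that the vertices can be settled one after the other as in Dijkstra's
   algorithm, the candidate value of an unsettled vertex being A / (1 - B) with
   A = 1 + sum ... and B = prod ... over the settled vertices.  Settling a vertex
   of least candidate value c preserves u <= A / (1 - B) for all settled values u
   because A and 1 - B grow by B q c and B q.
     A solution h of these equations is the optimal value by a potential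
   argument: E[min(tau, t)] + E[h(X_t); tau > t] is at least h(s) for every
   policy, with equality for the policy above; now let t go to infinity. *)

Require Import Defs.
From HB Require Import structures.
From mathcomp Require Import all_boot all_order all_algebra finmap.
From mathcomp Require Import all_classical all_reals all_analysis.
From mathcomp Require Import measurable_realfun ring lra zify.

Set Implicit Arguments.
Unset Strict Implicit.
Unset Printing Implicit Defensive.

Import Order.TTheory GRing.Theory Num.Theory.
Local Open Scope ring_scope.

(** * Random snapshots and policies *)

Section Snapshots.
Variables (R : realType) (n : nat).
Implicit Types (q : vedge n -> R) (g : snapshot n) (h : 'I_n -> R).

Definition snapshot_prob q g : R :=
  \prod_(e : vedge n) (if e \in g then q e else 1 - q e).

Lemma snapshot_prob_ge0 q g : (forall e, 0 <= q e <= 1) ->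
  0 <= snapshot_prob q g.
Proof.
move=> q01; apply: prodr_ge0 => e _; have /andP[q0 q1] := q01 e.
by case: ifP => // _; rewrite subr_ge0.
Qed.

Lemma sum_snapshot_prob q : \sum_g snapshot_prob q g = 1.
Proof.
rewrite /snapshot_prob -bigA_distr.
by rewrite big1 // => e _ /=; rewrite addrC subrK.
Qed.

(** Fixing the state of one edge leaves a product law in which that edge has probability 0 or 1, so
    conditioning can be iterated in an induction over edges. *)
Lemma snapshot_prob_cond q (e0 : vedge n) (c : bool) (f : snapshot n -> R) :
  \sum_(g : snapshot n | (e0 \in g) == c) snapshot_prob q g * f g =
  (if c then q e0 else 1 - q e0) *
    \sum_g snapshot_prob [eta q with e0 |-> c%:R] g * f g.
Proof.
rewrite mulr_sumr [RHS](bigID (fun g : snapshot n => (e0 \in g) == c)) /=.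
rewrite [X in _ = _ + X]big1 ?addr0 => [|g /negbTE gc]; last first.
  rewrite /snapshot_prob (bigD1 e0) //= eqxx.
  by move: gc; case: (e0 \in g); case: c => //= _; rewrite ?subrr !mul0r mulr0.
apply: eq_bigr => g /eqP gc; rewrite mulrA; congr (_ * _).
rewrite /snapshot_prob !(bigD1 (P := predT) e0) //= eqxx gc mulrA; congr (_ * _).
  by case: (c); rewrite /= ?subr0 mulr1.
by apply: eq_bigr => e /negbTE /= ->.
Qed.

(* [h u] for the first [u] in [l] with [{v, u}] open, and [d] if there is none. *)
Definition first_open h (v : 'I_n) l (d : R) g : R :=
  head d [seq h u | u <- l & [set v; u]%SET \in g].

Definition first_open_mean q h (v : 'I_n) l (d : R) : R :=
  foldr (fun u a => q [set v; u]%SET * h u + (1 - q [set v; u]%SET) * a) d l.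

Lemma eq_first_open_mean q q' h h' v l d :
  {in l, forall u, q [set v; u]%SET = q' [set v; u]%SET} -> {in l, h =1 h'} ->
  first_open_mean q h v l d = first_open_mean q' h' v l d.
Proof.
elim: l => //= u l IHl qq hh; rewrite qq ?hh ?mem_head // IHl // => x xl.
  by apply: qq; rewrite inE xl orbT.
by apply: hh; rewrite inE xl orbT.
Qed.

(** Condition on the edge to the head of [l]. As [l] is duplicate-free and avoids [v], the other
    edges [{v, x}] are different sets and keep their probabilities. *)
Lemma sum_first_open q h v l d : uniq l -> v \notin l ->
  \sum_g snapshot_prob q g * first_open h v l d g = first_open_mean q h v l d.
Proof.
elim: l q => [|u l IHl] q /=.
  by move=> _ _; rewrite -mulr_suml sum_snapshot_prob mul1r.
case/andP=> ul Ul; rewrite inE negb_or => /andP[vu vl].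
rewrite (bigID (fun g : snapshot n => ([set v; u]%SET \in g) == true)) /=.
congr (_ + _).
  have := snapshot_prob_cond q [set v; u]%SET true (fun=> h u).
  rewrite -mulr_suml sum_snapshot_prob mul1r => <-.
  by apply: eq_bigr => g /eqP gu; rewrite /first_open /= gu.
rewrite (eq_bigl (fun g : snapshot n => ([set v; u]%SET \in g) == false)); last first.
  by move=> g; case: (_ \in g).
under eq_bigr => g /eqP gu.
  rewrite /first_open /= gu -/(first_open h v l d g); over.
rewrite (snapshot_prob_cond q _ false) IHl //; congr (_ * _).
apply: eq_first_open_mean => // x xl /=; case: eqP => // e.
have: x \in [set v; u]%SET by rewrite -e set22.
rewrite !inE => /orP[] /eqP xE; first by rewrite -xE xl in vl.
by rewrite -xE xl in ul.
Qed.

(** The greedy policy when [l] is sorted by the potential: only predecessors of [v] count as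
    improvements, and the default [v] means waiting. *)
Definition open_choice (l : seq 'I_n) : policy n := fun _ g v =>
  head v [seq u <- take (index v l) l | [set v; u]%SET \in g].

Lemma feasible_open_choice l : feasible (open_choice l).
Proof.
move=> past g v; rewrite /open_choice.
case E: [seq _ <- _ | _] => [|u s] /=; [by left|right].
by have := mem_head u s; rewrite -E mem_filter => /andP[].
Qed.

(* For [l] sorted by [h], the last clause is the Bellman equation. *)
Definition potential q h (y : 'I_n) (l : seq 'I_n) : Prop :=
  [/\ uniq l, forall v, v \in l, h y = 0 /\ (forall v, 0 <= h v),
      pairwise (fun a b => h a <= h b) l
    & forall v, v != y ->
        h v = 1 + first_open_mean q h v (take (index v l) l) (h v)].

Lemma open_choice_mean q h y l past v : potential q h y l -> v != y ->
  \sum_g snapshot_prob q g * h (open_choice l past g v) = h v - 1.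
Proof.
case=> Ul al [_ _] _ hE vy; rewrite [h v in RHS]hE // addrC addrA addNr add0r.
rewrite -sum_first_open ?take_uniq //; last first.
  by rewrite in_take ?ltnn.
apply: eq_bigr => g _; congr (_ * _).
by rewrite /first_open /open_choice; case: [seq _ <- _ | _].
Qed.

(** As [l] is sorted by [h], the first open predecessor has the least [h] among the available moves,
    and nothing after [v] is better than waiting. *)
Lemma first_open_le q h y l g v u : potential q h y l ->
  u = v \/ [set v; u]%SET \in g ->
  first_open h v (take (index v l) l) (h v) g <= h u.
Proof.
case=> Ul al [_ _] hl _ uv.
have lep a b : (index a l <= index b l)%N -> h a <= h b.
  rewrite leq_eqVlt => /orP[/eqP e|ab].
    by rewrite -(nth_index v (al a)) -(nth_index v (al b)) e.
  rewrite -(nth_index v (al a)) -(nth_index v (al b)).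
  by apply: (pairwiseP v hl) => //; rewrite inE index_mem.
(* Generalised to suffixes of the predecessor list, under the invariant that [u] does not occur
   before position [m]. *)
suff H : forall m, (m <= index v l)%N -> (m <= index u l)%N -> 
   first_open h v (drop m (take (index v l) l)) (h v) g <= h u.
  by rewrite -[X in first_open _ _ X]drop0; apply: H.
move=> m; have [k] := ubnP (index v l - m)%N.
elim: k m => // k IHk m; rewrite ltnS => km mv mu.
have sz : size (take (index v l) l) = index v l by rewrite size_takel // index_size.
move: mv; rewrite leq_eqVlt => /orP[/eqP mE|mv].
  by rewrite drop_oversize ?sz ?mE // /first_open /= lep // -mE.
rewrite (drop_nth v) ?sz // nth_take // /first_open /=.
have ml : (m < size l)%N by rewrite (leq_trans mv) // index_size.
case: ifP => [|no] /=.
  by move=> _; rewrite lep // index_uniq.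
apply: IHk => //; first by lia.
(* The closed edge at position [m] excludes [u] from there unless [u = v], but [v] sits strictly
   beyond [m]. *)
rewrite ltn_neqAle mu andbT; apply/eqP => mE.
have mu' : nth v l m = u by rewrite mE nth_index.
rewrite mu' in no; case: uv => [uE|]; last by rewrite no.
by rewrite mE uE ltnn in mv.
Qed.

(** * Expectations over histories and the drift of the potential *)

Fixpoint history_mean q t (f : seq (snapshot n) -> R) past : R :=
  if t is t'.+1 then
    \sum_g snapshot_prob q g * history_mean q t' f (rcons past g)
  else f past.

(** [history_mean] unfolds at the first new snapshot, whereas the one-step drift concerns the last
    one. *)
Lemma history_meanSr q t f past :
  history_mean q t.+1 f past =
  history_mean q t (fun hs => \sum_g snapshot_prob q g * f (rcons hs g)) past.
Proof.
by elim: t past => //= t IHt past; apply: eq_bigr => g _; rewrite -IHt.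
Qed.

Lemma ler_history_mean q t f f' past : (forall e, 0 <= q e <= 1) ->
  (forall hs, f hs <= f' hs) ->
  history_mean q t f past <= history_mean q t f' past.
Proof.
move=> q01 ff; elim: t past => //= t IHt past.
by apply: ler_sum => g _; rewrite ler_wpM2l // snapshot_prob_ge0.
Qed.

Lemma history_meanB q t f f' past :
  history_mean q t (fun hs => f hs - f' hs) past =
  history_mean q t f past - history_mean q t f' past.
Proof.
elim: t past => //= t IHt past; rewrite -sumrB.
by apply: eq_bigr => g _; rewrite IHt mulrBr.
Qed.

Lemma history_meanZ q t f c past :
  history_mean q t (fun hs => f hs * c) past = history_mean q t f past * c.
Proof.
elim: t past => //= t IHt past; rewrite mulr_suml.
by apply: eq_bigr => g _; rewrite IHt mulrA.
Qed.

Lemma eq_history_mean q t f f' past : f =1 f' ->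
  history_mean q t f past = history_mean q t f' past.
Proof. by move=> /boolp.funext ->. Qed.

Definition position (pi : policy n) (s : 'I_n) (hs : seq (snapshot n)) : 'I_n :=
  (foldl (fun x g => (rcons x.1 g, pi x.1 g x.2)) ([::], s) hs).2.

Lemma position_rcons pi s hs g :
  position pi s (rcons hs g) = pi hs g (position pi s hs).
Proof.
rewrite /position foldl_rcons /=; congr (pi _ _ _).
by elim/last_ind: hs => // hs g' IH; rewrite foldl_rcons /= IH.
Qed.

(** The event tau > t for t = [size hs]; the range includes both time 0 and time t. *)
Definition travelling pi s (y : 'I_n) hs : bool :=
  all (fun i => position pi s (take i hs) != y) (iota 0 (size hs).+1).

Lemma travelling_rcons pi s y hs g :
  travelling pi s y (rcons hs g) =
  travelling pi s y hs && (position pi s (rcons hs g) != y).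
Proof.
rewrite /travelling size_rcons -[(size hs).+2]addn1 iotaD all_cat /= andbT.
rewrite add0n -[in take (size hs).+1 _](size_rcons hs g) take_size; congr andb.
have h i : i \in iota 0 (size hs).+1 ->
    (position pi s (take i (rcons hs g)) != y) =
    (position pi s (take i hs) != y).
  by rewrite mem_iota add0n ltnS => /= ih; rewrite -cats1 takel_cat.
exact: (eq_in_all h).
Qed.

Lemma travelling_position pi s y hs :
  travelling pi s y hs -> position pi s hs != y.
Proof.
by move=> /allP/(_ (size hs)); rewrite take_size mem_iota add0n ltnSn; apply.
Qed.

(* P(tau > t) and E[h(X_t); tau > t]. *)
Definition survival q pi s y t : R :=
  history_mean q t (fun hs => (travelling pi s y hs)%:R) [::].

Definition remaining q pi s y h t : R :=
  history_mean q t
    (fun hs => (travelling pi s y hs)%:R * h (position pi s hs)) [::].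

(** Because [h y = 0], a walk arriving at this very step contributes nothing, so the indicator of
    tau > t + 1 may be weakened to that of tau > t. *)
Lemma remainingS q pi s y h t : h y = 0 ->
  remaining q pi s y h t.+1 = history_mean q t (fun hs =>
    (travelling pi s y hs)%:R *
      \sum_g snapshot_prob q g * h (pi hs g (position pi s hs))) [::].
Proof.
move=> hy; rewrite /remaining history_meanSr; apply: eq_history_mean => hs.
rewrite mulr_sumr; apply: eq_bigr => g _.
rewrite [RHS]mulrCA travelling_rcons position_rcons; congr (_ * _).
by case: travelling => /=; rewrite ?mul0r //; case: eqP => [->|]; rewrite ?hy ?mulr0.
Qed.

Lemma remaining_survival q pi s y h t :
  remaining q pi s y h t - survival q pi s y t = history_mean q t (fun hs =>
    (travelling pi s y hs)%:R * (h (position pi s hs) - 1)) [::].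
Proof.
rewrite -history_meanB; apply: eq_history_mean => hs.
by rewrite mulrBr mulr1.
Qed.

(** No feasible move beats the first open predecessor, whose mean potential is [h - 1] by the
    Bellman equation; so the mean drop per step is at most P(tau > t). *)
Lemma remaining_ge q pi s y h l t : (forall e, 0 <= q e <= 1) ->
  potential q h y l -> feasible pi ->
  remaining q pi s y h t - survival q pi s y t <= remaining q pi s y h t.+1.
Proof.
move=> q01 pot fpi; case: (pot) => _ _ [hy _] _ _.
rewrite remaining_survival remainingS //; apply: ler_history_mean => // hs.
case: (boolP (travelling _ _ _ _)) => [/travelling_position vy|_].
  rewrite !mul1r -(open_choice_mean hs pot vy); apply: ler_sum => g _.
  rewrite ler_wpM2l ?snapshot_prob_ge0 //.
  apply: le_trans (first_open_le pot (fpi hs g (position pi s hs))).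
  by rewrite /open_choice /first_open; case: [seq _ <- _ | _].
by rewrite !mul0r.
Qed.

Lemma remaining_open_choice q s y h l t : potential q h y l ->
  remaining q (open_choice l) s y h t.+1 =
  remaining q (open_choice l) s y h t - survival q (open_choice l) s y t.
Proof.
move=> pot; case: (pot) => _ _ [hy _] _ _.
rewrite remaining_survival remainingS //; apply: eq_history_mean => hs.
case: (boolP (travelling _ _ _ _)) => [/travelling_position vy|_].
  by rewrite !mul1r (open_choice_mean hs pot vy).
by rewrite !mul0r.
Qed.

Lemma remaining0 q pi s y h : h y = 0 -> remaining q pi s y h 0 = h s.
Proof.
move=> hy; rewrite /remaining /= /travelling /= andbT /position /=.
by case: eqP => [->|]; rewrite ?hy ?mulr0 // mul1r.
Qed.

(** Telescoping of the one-step bound; the sum of survival probabilities is E[min(tau, t)]. *)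
Lemma potential_le_survival q pi s y h l t : (forall e, 0 <= q e <= 1) ->
  potential q h y l -> feasible pi ->
  h s <= \sum_(i < t) survival q pi s y i + remaining q pi s y h t.
Proof.
move=> q01 pot fpi; elim: t => [|t IHt].
  by case: pot => _ _ [hy _] _ _; rewrite big_ord0 add0r remaining0.
apply: le_trans IHt _; rewrite big_ord_recr /= -addrA lerD2l addrC -lerBlDr.
exact: remaining_ge pot fpi.
Qed.

Lemma sum_survival_open_choice q s y h l t : (forall e, 0 <= q e <= 1) ->
  potential q h y l ->
  \sum_(i < t) survival q (open_choice l) s y i <= h s.
Proof.
move=> q01 pot; case: (pot) => _ _ [hy h0] _ _.
have <- : \sum_(i < t) survival q (open_choice l) s y i +
    remaining q (open_choice l) s y h t = h s.
  elim: t => [|t IHt]; first by rewrite big_ord0 add0r remaining0.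
  rewrite big_ord_recr /= (remaining_open_choice _ _ pot) -IHt; ring.
rewrite lerDl -[X in X <= _](mulr0 (history_mean q t (fun=> 0) [::])).
rewrite -history_meanZ; apply: ler_history_mean => // hs.
by rewrite mul0r mulr_ge0.
Qed.

Lemma remaining_le q pi s y h t M : (forall e, 0 <= q e <= 1) ->
  (forall v, h v <= M) ->
  remaining q pi s y h t <= survival q pi s y t * M.
Proof.
move=> q01 hM; rewrite -history_meanZ; apply: ler_history_mean => // hs.
by rewrite ler_wpM2l.
Qed.

End Snapshots.

(** * Expected arrival times *)

Section MemorylessGraph.
Local Open Scope classical_set_scope.
Variables (R : realType) (n : nat) (E : snapshot n) (p : vedge n -> R).
Hypothesis p01 : edge_probabilities E p.

(** [p] is constrained on [E] only; the extension by 0 puts a product law on all sets of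
    vertices. *)
Definition edge_prob (e : vedge n) : R := if e \in E then p e else 0.

Lemma edge_prob01 e : 0 <= edge_prob e <= 1.
Proof. by rewrite /edge_prob; case: ifP => [/p01//|_]; rewrite lexx ler01. Qed.

Variables (d : measure_display) (T : measurableType d) (P : probability T R).
Variable G : nat -> T -> snapshot n.
Hypothesis GP : memoryless P E p G.

Lemma nonedge_closed t e : (0 < t)%N -> e \notin E ->
  [set w | e \in G t w] = set0.
Proof.
case: GP => GE _ _ t0 /negP eE; apply/seteqP; split=> w //= eG.
by apply: eE; exact: (fintype.subsetP (GE t w t0)).
Qed.

Lemma measurable_open t e : (0 < t)%N -> measurable [set w | e \in G t w].
Proof.
move=> t0; have [eE|eE] := boolP (e \in E); last by rewrite nonedge_closed.
by case: GP => _ /(_ t e t0 eE)[].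
Qed.

(** * Joint law of finitely many edge states and of the history *)

Definition pattern (b : pred (nat * vedge n)) (l : seq (nat * vedge n)) :=
  [set w | all (fun te => (te.2 \in G te.1 w) == b te) l].

Lemma measurable_pattern b l : {in l, forall te, (0 < te.1)%N} ->
  measurable (pattern b l).
Proof.
rewrite /pattern; elim: l => [_|te l IHl l0] /=.
  by rewrite [X in measurable X](_ : _ = setT) //; apply/seteqP; split.
rewrite [X in measurable X](_ : _ =
  [set w | (te.2 \in G te.1 w) == b te] `&` pattern b l); last first.
  by apply/seteqP; split=> w /=; [case/andP|case=> -> ->].
apply: measurableI; last first.
  by apply: IHl => x xl; apply: l0; rewrite inE xl orbT.
have m : measurable [set w | te.2 \in G te.1 w].
  by apply: measurable_open; apply: l0; rewrite mem_head.
case: (b te).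
  by rewrite [X in measurable X](_ : _ = [set w | te.2 \in G te.1 w]) //;
    apply/seteqP; split=> w /=; [move/eqP|move=> ->].
rewrite [X in measurable X](_ : _ = ~` [set w | te.2 \in G te.1 w]).
  exact: measurableC.
apply/seteqP; split=> w /=; first by move/eqP ->.
by move=> /negP/negbTE ->.
Qed.

Lemma probability_all_open (l : seq (nat * vedge n)) : uniq l ->
  {in l, forall te, (0 < te.1)%N} -> {in l, forall te, te.2 \in E} ->
  P (pattern xpredT l) = (\prod_(te <- l) edge_prob te.2)%:E.
Proof.
case: GP => _ Gp ind Ul l0 lE.
have lJ : [fset x in l]%fset =i l by move=> x; rewrite in_fset.
have := ind [fset x in l]%fset; rewrite (_ : \bigcap_(_ in _) _ = pattern xpredT l).
  move=> ->; last by move=> te /=; rewrite lJ => tel; split; [apply: l0|apply: lE].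
  rewrite (perm_big l) /=; last by apply: uniq_perm => //; exact: fset_uniq.
  rewrite big_seq [in RHS]big_seq -prodEFin.
  apply: eq_bigr => te tel; rewrite /edge_prob (lE _ tel).
  by have [] := Gp te.1 te.2 (l0 _ tel) (lE _ tel).
apply/seteqP; split=> w /=.
  move=> H; apply/allP => te tel; rewrite eqb_id; apply: H => /=.
  by rewrite lJ.
by move=> /allP H te /=; rewrite lJ => /H; rewrite eqb_id.
Qed.

(** Independence is given for open edges only. Closed ones follow from P(B \ A) = P(B) - P(A and B);
    for a nonedge, A is empty. *)
Lemma probability_pattern b (l : seq (nat * vedge n)) : uniq l ->
  {in l, forall te, (0 < te.1)%N} ->
  P (pattern b l) =
    (\prod_(te <- l) (if b te then edge_prob te.2 else 1 - edge_prob te.2))%:E.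
Proof.
(* The induction moves pairs from [l2], with arbitrary states, to [l1], where all are open edges of
   [E]. *)
suff H l1 l2 : uniq (l1 ++ l2) -> {in l1 ++ l2, forall te, (0 < te.1)%N} ->
    {in l1, forall te, te.2 \in E} ->
    P (pattern xpredT l1 `&` pattern b l2) =
      (\prod_(te <- l1) edge_prob te.2 *
       \prod_(te <- l2)
         (if b te then edge_prob te.2 else 1 - edge_prob te.2))%:E.
  move=> Ul l0; have := H [::] l Ul l0.
  rewrite big_nil mul1r => <- //; congr (P _).
  by rewrite /pattern; apply/seteqP; split=> w //= -[].
elim: l2 l1 => [|te l2 IHl2] l1.
  rewrite cats0 big_nil mulr1 => Ul l0 lE.
  rewrite -probability_all_open //; congr (P _).
  by apply/seteqP; split=> w //= -[].
move=> Ul l0 lE; rewrite big_cons.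
have te0 : (0 < te.1)%N by apply: l0; rewrite mem_cat mem_head orbT.
have Ul' : uniq (l1 ++ l2).
  apply: subseq_uniq Ul; apply: cat_subseq => //; exact: subseq_cons.
have l0' : {in l1 ++ l2, forall te, (0 < te.1)%N}.
  move=> x xl; apply: l0; move: xl; rewrite !mem_cat inE.
  by case/orP=> ->; rewrite ?orbT.
have Ulc : uniq ((te :: l1) ++ l2).
  by rewrite -(perm_uniq (permEl (perm_catCA l1 [:: te] l2))).
have l0c : {in (te :: l1) ++ l2, forall te, (0 < te.1)%N}.
  move=> x xl; apply: l0; move: xl; rewrite /= !mem_cat !inE mem_cat.
  by case/or3P=> ->; rewrite ?orbT.
set A := [set w | te.2 \in G te.1 w].
have openE : P (A `&` (pattern xpredT l1 `&` pattern b l2)) =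
    (edge_prob te.2 * (\prod_(te <- l1) edge_prob te.2 *
       \prod_(te <- l2)
         (if b te then edge_prob te.2 else 1 - edge_prob te.2)))%:E.
  have [eE|eE] := boolP (te.2 \in E); last first.
    by rewrite /A nonedge_closed // set0I measure0 /edge_prob (negbTE eE) mul0r.
  have := IHl2 (te :: l1) Ulc l0c; rewrite big_cons -mulrA => <-; last first.
    by move=> x; rewrite inE => /orP[/eqP ->//|/lE].
  congr (P _); rewrite setIA; congr (_ `&` _).
  by apply/seteqP; split=> w; rewrite /A /pattern /= eqb_id; [case=> -> ->|case/andP].
case bte: (b te).
  rewrite mulrCA -openE; congr (P _); rewrite setICA; congr (_ `&` _).
  apply/seteqP; split=> w; rewrite /A /pattern /= bte eqb_id; first by case/andP.
  by case=> -> ->.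
have -> : pattern xpredT l1 `&` pattern b (te :: l2) =
    (pattern xpredT l1 `&` pattern b l2) `\` A.
  rewrite setDE -setIA; congr (_ `&` _).
  apply/seteqP; split=> w; rewrite /A /pattern /= bte.
    by case/andP=> /eqP te_closed ->; rewrite te_closed.
  by case=> -> /negP/negbTE ->.
set B := pattern xpredT l1 `&` pattern b l2.
have mB : measurable B.
  by apply: measurableI; apply: measurable_pattern => x xl; apply: l0';
    rewrite mem_cat xl ?orbT.
have -> : P (B `\` A) = (P B - P (A `&` B))%E.
  rewrite (setIC A) measureD //; first exact: measurable_open.
  exact: le_lt_trans (probability_le1 _ _) (ltry _).
rewrite openE IHl2 // -EFinB; congr EFin; ring.
Qed.

Definition history t w := [seq G i w | i <- iota 1 t].

Lemma historyS t w : history t.+1 w = rcons (history t w) (G t.+1 w).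
Proof. by rewrite /history -[t.+1]addn1 iotaD map_cat /= cats1 add1n addn1. Qed.

Lemma size_history t w : size (history t w) = t.
Proof. by rewrite size_map size_iota. Qed.

(** Times start at 1 but positions in [past] at 0, whence the predecessor of [te.1]. *)
Let history_pattern t past : size past = t ->
  [set w | history t w = past] =
  pattern (fun te => te.2 \in nth finset.set0 past te.1.-1)
    [seq (i, e) | i <- iota 1 t, e <- enum {: vedge n}].
Proof.
move=> szp; apply/seteqP; split=> w; rewrite /pattern /=.
  move=> hp; apply/allP => te /allpairsP[[i e] /= [it _ ->]] /=.
  move: it; rewrite mem_iota => /andP[i0 it]; rewrite -hp /history.
  rewrite (nth_map 0%N) ?size_iota ?nth_iota; by [lia|rewrite add1n prednK].
move=> /allP H; apply: (@eq_from_nth _ finset.set0); first by rewrite size_history.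
rewrite size_history => i it; rewrite /history (nth_map 0%N) ?size_iota //.
rewrite nth_iota // add1n; apply/setP => e.
have /= := H (i.+1, e); move/(_ _)/eqP; apply.
by apply/allpairsP; exists (i.+1, e); rewrite mem_iota mem_enum; split=> //=; lia.
Qed.

Let positive_times t : {in [seq (i, e) | i <- iota 1 t, e <- enum {: vedge n}],
  forall te : nat * vedge n, (0 < te.1)%N}.
Proof. by move=> te /allpairsP[[i e] /= []]; rewrite mem_iota => /andP[? _] _ ->. Qed.

Lemma measurable_history t past : size past = t ->
  measurable [set w | history t w = past].
Proof. by move=> szp; rewrite history_pattern //; exact: measurable_pattern. Qed.

Lemma probability_history t past : size past = t ->
  P [set w | history t w = past] =
  (\prod_(g <- past) snapshot_prob edge_prob g)%:E.
Proof.
move=> szp; rewrite history_pattern // probability_pattern //; last first.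
  by apply: allpairs_uniq => //; [exact: iota_uniq|exact: enum_uniq|move=> [? ?] [? ?]].
congr EFin; rewrite big_allpairs (big_nth finset.set0) szp /index_iota subn0.
rewrite (iotaDl 1 0) big_map; apply: eq_bigr => i _.
by rewrite /snapshot_prob big_enum; apply: eq_bigr => e _ /=.
Qed.

(** Splitting by the next snapshot gives finitely many disjoint events, which matches the recursion
    of [history_mean]. *)
Lemma probability_history_mean t k (f : pred (seq (snapshot n))) past :
  size past = k ->
  measurable [set w | f (history (k + t) w) /\ history k w = past] /\
  P [set w | f (history (k + t) w) /\ history k w = past] =
  (\prod_(g <- past) snapshot_prob edge_prob g *
     history_mean edge_prob t (fun hs => (f hs)%:R) past)%:E.
Proof.
elim: t k past => [|t IHt] k past szp.
  rewrite addn0 /=; case fp: (f past).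
    rewrite mulr1 -(probability_history szp).
    rewrite [X in measurable X /\ P X = _](_ : _ = [set w | history k w = past]).
      by split=> //; exact: measurable_history.
    by apply/seteqP; split=> w /=; [case|move=> hp; rewrite hp fp].
  rewrite mulr0 [X in measurable X /\ P X = _](_ : _ = set0) ?measure0 //.
  by apply/seteqP; split=> w //= -[+ hp]; rewrite hp fp.
set S := [set w | _].
pose F g := [set w | f (history (k.+1 + t) w) /\ history k.+1 w = rcons past g].
have SF : S = \bigcup_g F g.
  apply/seteqP; split=> w; rewrite /S /F /=.
    by move=> [fw hw]; exists (G k.+1 w) => //=; rewrite addSnnS historyS hw.
  by move=> [g _ /=]; rewrite addSnnS historyS => -[fw /rcons_inj[-> _]].
have IH g := IHt k.+1 (rcons past g).
have szr g : size (rcons past g) = k.+1 by rewrite size_rcons szp.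
have fin : finite_set [set: snapshot n] by exact: finite_finset.
have mF g : measurable (F g) by have [] := IH g (szr g).
rewrite SF; split; first exact: fin_bigcup_measurable.
rewrite measure_fin_bigcup //; last first.
  move=> g g' _ _ [w [/= [_ hg] [_ hg']]].
  by move: hg'; rewrite hg => /rcons_inj[].
rewrite fsbig_finite //= mulr_sumr -sumEFin.
rewrite (perm_big (index_enum _)) /=; last first.
  apply: uniq_perm; rewrite ?fset_uniq ?index_enum_uniq // => g.
  by rewrite in_fset_set // mem_index_enum; exact: mem_set.
apply: eq_bigr => g _; rewrite (IH g (szr g)).2; congr EFin.
rewrite big_rcons /=; ring.
Qed.

Lemma probability_history_mean0 t (f : pred (seq (snapshot n))) :
  measurable [set w | f (history t w)] /\
  P [set w | f (history t w)] =
    (history_mean edge_prob t (fun hs => (f hs)%:R) [::])%:E.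
Proof.
have := @probability_history_mean t 0 f [::] erefl.
rewrite add0n big_nil mul1r (_ : [set w | _ /\ _] = [set w | f (history t w)]) //.
by apply/seteqP; split=> w //= -[].
Qed.

(** * Tail-sum formula for the arrival time and optimality *)

Lemma walkE pi s w t : walk pi G s w t = position pi s (history t w).
Proof. by elim: t => //= t ->; rewrite historyS position_rcons. Qed.

Lemma travelling_history pi s y t w :
  travelling pi s y (history t w) =
  all (fun i => walk pi G s w i != y) (iota 0 t.+1).
Proof.
rewrite /travelling size_history; apply: eq_in_all => i.
rewrite mem_iota add0n ltnS => /= it; rewrite walkE /history -map_take.
by rewrite take_iota (minn_idPl it).
Qed.

(** The indicators of tau > t are 1 before the arrival and 0 from then on; if [y] is never reached,
    the series of ones diverges. *)
Lemma arrival_time_series pi s y w :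
  arrival_time R (walk pi G s w) y =
  (\sum_(t <oo) (\1_[set w | travelling pi s y (history t w)] w)%:E)%E.
Proof.
have tE t : \1_[set w | travelling pi s y (history t w)] w =
    (travelling pi s y (history t w))%:R :> R by rewrite indicE mem_setE.
have [[t0 t0y]|never] := pselect (exists t, walk pi G s w t = y).
  have [t ty tmin] := @ex_minnP (fun t => walk pi G s w t == y)
    (ex_intro _ t0 (introT eqP t0y)).
  rewrite (nneseries_split 0 t); last by move=> k _; rewrite lee_fin.
  rewrite [X in (_ + X)%E]eseries0 ?adde0; last first.
    move=> i; rewrite add0n => ti _; rewrite tE travelling_history.
    suff /negbTE -> : ~~ all (fun i => walk pi G s w i != y) (iota 0 i.+1) by [].
    by apply/allPn; exists t; rewrite ?negbK // mem_iota add0n ltnS.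
  rewrite add0n big_nat (eq_bigr (fun=> 1%E)) => [|i /andP[_ it]]; last first.
    rewrite tE travelling_history (_ : all _ _) //; apply/allP => j.
    rewrite mem_iota add0n => /= ji; apply/negP => /tmin; lia.
  rewrite -big_nat sumEFin big_const_nat subn0 iter_addr addr0.
  apply/eqP; rewrite eq_le; apply/andP; split.
    by apply: ereal_inf_lbound; exists t => //=; apply/eqP.
  apply: le_ereal_inf_tmp => _ [j /= jy <-]; rewrite lee_fin ler_nat tmin //.
  exact/eqP.
rewrite /arrival_time (_ : [set t | _] = set0); last first.
  by apply/seteqP; split=> t //= ty; apply: never; exists t.
rewrite image_set0 ereal_inf0.
rewrite (eq_eseriesr (g := fun=> 1%E)); last first.
  move=> i _; rewrite tE travelling_history (_ : all _ _) //; apply/allP => j _.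
  by apply/eqP => jy; apply: never; exists j.
apply/esym/eqyP => r r0.
apply: le_trans (nneseries_lim_ge (Num.truncn r).+1 _) => [|//].
rewrite sumEFin big_const_nat subn0 iter_addr addr0 lee_fin.
by rewrite ltW // truncnS_gt.
Qed.

Lemma expected_arrivalE pi s y :
  expected_arrival P G pi s y =
  (\sum_(t <oo) (survival edge_prob pi s y t)%:E)%E.
Proof.
rewrite /expected_arrival; under eq_integral do rewrite arrival_time_series.
have m t := (probability_history_mean0 t (travelling pi s y)).1.
rewrite integral_nneseries //.
- apply: eq_eseriesr => t _; rewrite integral_indic // setIT.
  exact: (probability_history_mean0 t (travelling pi s y)).2.
- by move=> t; apply/measurable_EFinP; exact: measurable_indic.
Qed.

Lemma potential_best_policy h y l : potential edge_prob h y l ->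
  forall v, best_policy_value P G v y (h v).
Proof.
move=> pot v.
have sv0 pi i : 0 <= survival edge_prob pi v y i.
  have := (probability_history_mean0 i (travelling pi v y)).2.
  by move=> PE; rewrite -lee_fin /survival -PE measure_ge0.
have up : (expected_arrival P G (open_choice l) v y <= (h v)%:E)%E.
  rewrite expected_arrivalE; apply: lime_le.
    by apply: is_cvg_nneseries => i _ _; rewrite lee_fin.
  apply: nearW => t; rewrite sumEFin lee_fin big_mkord.
  exact: sum_survival_open_choice edge_prob01 pot.
(* The passage to the limit is by contradiction: a value below [h v] would keep every survival
   probability above a positive constant, so their series would diverge. *)
have lo pi : feasible pi -> ((h v)%:E <= expected_arrival P G pi v y)%E.
  move=> fpi; rewrite expected_arrivalE leNgt; apply/negP => lt_h.
  set S := (\sum_(t <oo) _)%E in lt_h.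
  have S0 : (0 <= S)%E by apply: nneseries_ge0 => i _ _; rewrite lee_fin.
  have Sfin : S \is a fin_num.
    by rewrite ge0_fin_numE // (lt_trans lt_h) // ltry.
  pose L := fine S.
  have LS : S = L%:E by rewrite fineK.
  have part t : \sum_(i < t) survival edge_prob pi v y i <= L.
    rewrite -lee_fin -LS -(big_mkord xpredT (survival edge_prob pi v y)) -sumEFin.
    by apply: nneseries_lim_ge => i _ _; rewrite lee_fin.
  rewrite LS lte_fin in lt_h.
  (* [M] bounds every [h u]; the summand 1 makes it positive for the division in [c]. *)
  pose M := 1 + \sum_u h u.
  have h0 u : 0 <= h u by case: pot => _ _ [].
  have M0 : 0 < M by rewrite /M ltr_pwDl // sumr_ge0.
  have hM u : h u <= M.
    rewrite /M (bigD1 u) //= addrCA lerDl addr_ge0 //.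
    by rewrite sumr_ge0.
  pose c := (h v - L) / M.
  have c0 : 0 < c by rewrite divr_gt0 // subr_gt0.
  have svc t : c <= survival edge_prob pi v y t.
    rewrite ler_pdivrMr // lerBlDl.
    apply: le_trans (potential_le_survival v t edge_prob01 pot fpi) _.
    by rewrite lerD // remaining_le // => e; exact: edge_prob01.
  have := part (Num.truncn (L / c)).+1; apply/negP; rewrite -ltNge.
  apply: lt_le_trans (_ : c *+ (Num.truncn (L / c)).+1 <= _); last first.
    rewrite -[X in _ *+ X]card_ord -sumr_const.
    by apply: ler_sum => i _.
  by rewrite -mulr_natl -ltr_pdivrMr // truncnS_gt.
have fo := feasible_open_choice l.
exists (open_choice l); split; last by apply/eqP; rewrite eq_le up lo.
by split=> // pi fpi; apply: le_trans up (lo _ fpi).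
Qed.

End MemorylessGraph.

(** * Settling the vertices in order *)

Section Dijkstra.
Variables (R : realType) (n : nat) (q : vedge n -> R) (y : 'I_n).
Hypothesis q01 : forall e, 0 <= q e <= 1.
Implicit Types (H A B : 'I_n -> R) (l : seq 'I_n).

(** For an unsettled [v] other than [y], [B v = 1] means that no settled vertex can be reached in
    one step, so that x = [A v] + [B v] x does not determine x. *)
Definition eligible H B v := (H v < 0) && (B v < 1).

Definition candidate A B v := A v / (1 - B v).

(* [l] lists the settled vertices; [H] is negative on the others. *)
Definition dijkstra_inv l H A B : Prop :=
  [/\ uniq l /\ pairwise (fun a b => H a <= H b) l,
      forall v, (v \in l) = (0 <= H v),
      forall v, v \notin l -> v != y ->
        [/\ B v = \prod_(u <- l) (1 - q [set v; u]%SET),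
            forall d, A v + B v * d = 1 + first_open_mean q H v l d
          & {in l, forall u, H u * (1 - B v) <= A v}],
      if y \in l then H y = 0 else [/\ l = [::], A y = 0 & B y = 0]
    & {in l, forall v, v != y ->
        H v = 1 + first_open_mean q H v (take (index v l) l) (H v)}].

Lemma first_open_mean_ge0 h v l d : {in l, forall u, 0 <= h u} -> 0 <= d ->
  0 <= first_open_mean q h v l d.
Proof.
move=> h0 d0; elim: l h0 => //= u l IHl h0.
have /andP[q0 q1] := q01 [set v; u]%SET.
rewrite addr_ge0 // mulr_ge0 ?subr_ge0 //; first by rewrite h0 ?mem_head.
by apply: IHl => x xl; rewrite h0 // inE xl orbT.
Qed.

Lemma first_open_mean_rcons h v l u d :
  first_open_mean q h v (rcons l u) d =
  first_open_mean q h v l (q [set v; u]%SET * h u + (1 - q [set v; u]%SET) * d).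
Proof. exact: foldr_rcons. Qed.

Lemma prod_closed01 v l : 0 <= \prod_(u <- l) (1 - q [set v; u]%SET) <= 1.
Proof.
rewrite prodr_ge0 => [|u _]; last by rewrite subr_ge0; case/andP: (q01 [set v; u]%SET).
apply: prodr_ile1 => u _; rewrite subr_ge0 gerBl.
by case/andP: (q01 [set v; u]%SET) => -> ->.
Qed.

(** The empty product makes [B] equal to 1 away from [y], so only [y] is eligible; its artificial
    [A = B = 0] yields the candidate 0. *)
Lemma dijkstra_init :
  dijkstra_inv [::] (fun=> -1) (fun v => if v == y then 0 else 1)
    (fun v => if v == y then 0 else 1).
Proof.
split=> //=; first by move=> v; rewrite ler0N1.
- move=> v _ /negbTE ->; split=> //; first by rewrite big_nil.
  by move=> d; rewrite mul1r.
- by rewrite eqxx.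
Qed.

Lemma dijkstra_eligible_notin l H A B v : dijkstra_inv l H A B ->
  eligible H B v -> v \notin l.
Proof. by case=> _ memH _ _ _ /andP[Hv _]; rewrite memH -ltNge. Qed.

(** This lets negative numbers serve as marks, both for unsettled vertices and for the absence of a
    best candidate. *)
Lemma dijkstra_candidate_ge0 l H A B v : dijkstra_inv l H A B ->
  eligible H B v -> 0 <= candidate A B v.
Proof.
move=> inv ev; have vl := dijkstra_eligible_notin inv ev.
case: inv ev => -[_ _] memH out yP _ /andP[_ Bv]; rewrite /candidate.
case: (eqVneq v y) => [vy|vy].
  by move: yP; rewrite -vy (negbTE vl) => -[_ -> _]; rewrite mul0r.
have [_ /(_ 0) AE _] := out v vl vy; rewrite mulr0 addr0 in AE.
apply: divr_ge0; last by rewrite subr_ge0 ltW.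
rewrite AE addr_ge0 // first_open_mean_ge0 // => u.
by rewrite memH.
Qed.

Lemma dijkstra_step l H A B a : dijkstra_inv l H A B -> eligible H B a ->
  (forall v, eligible H B v -> candidate A B a <= candidate A B v) ->
  dijkstra_inv (rcons l a) [eta H with a |-> candidate A B a]
    (fun v => A v + B v * q [set v; a]%SET * candidate A B a)
    (fun v => B v - B v * q [set v; a]%SET).
Proof.
move=> inv ea; have al := dijkstra_eligible_notin inv ea.
have c0 := dijkstra_candidate_ge0 inv ea.
case: inv ea => -[Ul pw] memH out yP inl /andP[Ha Ba] cmin.
set c := candidate A B a in c0 cmin *.
have H0 : {in l, forall u, 0 <= H u} by move=> u; rewrite memH.
have Bge0 v : v \notin l -> v != y -> 0 <= B v <= 1.
  by move=> vl /(out v vl)[-> _ _]; exact: prod_closed01.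
have Age0 v : v \notin l -> v != y -> 0 <= A v.
  move=> vl /(out v vl)[_ /(_ 0) AE _]; rewrite mulr0 addr0 in AE.
  by rewrite AE addr_ge0 // first_open_mean_ge0.
(* While [y] is unsettled [l] is empty and every other vertex has [B = 1], so the eligible [a] must
   be [y]. *)
have yl : (y \in l) = (a != y).
  case: (boolP (y \in l)) => yl; first by apply/esym/eqP => ay; rewrite ay yl in al.
  move: yP; rewrite (negbTE yl) => -[l0 _ _]; case: eqP => // /eqP ay.
  by have [BE _ _] := out a al ay; rewrite l0 big_nil in BE; rewrite BE ltxx in Ba.
have cE : c * (1 - B a) = A a.
  by rewrite /c /candidate divfK // subr_eq0 gt_eqF.
(* The invariant bound at [a], divided by [1 - B a]; it keeps the list sorted when [a] is
   appended. *)
have Hc : {in l, forall u, H u <= c}.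
  move=> u ul; case: (eqVneq a y) => [ay|ay].
    by move: yP ul; rewrite yl ay eqxx => -[-> _ _].
  have [_ _ /(_ u ul) le] := out a al ay.
  by rewrite /c /candidate ler_pdivlMr // subr_gt0.
have H'E : {in l, [eta H with a |-> c] =1 H}.
  by move=> u ul /=; case: eqP => // ua; rewrite -ua ul in al.
split.
- rewrite rcons_uniq al Ul pairwise_rcons; split=> //; apply/andP; split.
    by apply/allP => u ul; rewrite H'E //= eqxx Hc.
  rewrite (eq_in_pairwise (P := mem l) (r' := fun a b => H a <= H b)) //.
    by move=> u v ul vl; rewrite !H'E.
- move=> v; rewrite mem_rcons inE memH /=.
  by case: eqP => [_|//]; rewrite c0.
- move=> v; rewrite mem_rcons inE negb_or => /andP[va vl] vy.
  have [BE AE le] := out v vl vy; have /andP[B0 B1] := Bge0 v vl vy.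
  have /andP[qv0 qv1] := q01 [set v; a]%SET.
  split.
  + by rewrite big_rcons /= -BE mulrBr mulr1.
  + move=> d; rewrite first_open_mean_rcons (eq_first_open_mean (q' := q) (h' := H)) //.
    rewrite -AE /= eqxx; ring.
  (* For any x in [0, c] the left side grows by [B v] q x and the right side by [B v] q c. *)
  + suff H' x : 0 <= x <= c -> x * (1 - B v) <= A v ->
      x * (1 - (B v - B v * q [set v; a]%SET)) <= A v + B v * q [set v; a]%SET * c.
      move=> u; rewrite mem_rcons inE => /orP[/eqP ->|ul].
        rewrite /= eqxx; apply: H'; first by rewrite c0 lexx.
        have [vB|] := boolP (B v < 1).
          have := cmin v; rewrite /eligible vB ltNge -memH vl => /(_ isT).
          by rewrite /candidate ler_pdivlMr // subr_gt0.
        (* Without a candidate to compare with, the bound degenerates to [0 <= A v]. *)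
        rewrite -leNgt => Bv; have -> : B v = 1 by apply/le_anti; rewrite B1 Bv.
        by rewrite subrr mulr0 Age0.
      by rewrite H'E //; apply: H'; [rewrite H0 // Hc|exact: le].
    move=> /andP[x0 xc] xle.
    have -> : x * (1 - (B v - B v * q [set v; a]%SET)) =
      x * (1 - B v) + B v * q [set v; a]%SET * x by ring.
    by rewrite lerD // ler_wpM2l // mulr_ge0.
- rewrite mem_rcons inE; move: yP; rewrite yl eq_sym.
  case: (eqVneq a y) => [<-|ay] /=; last by rewrite eq_sym (negbTE ay).
  by rewrite eqxx => -[_ Ay _]; rewrite /c /candidate Ay mul0r.
- move=> v; rewrite mem_rcons inE => /orP[/eqP ->|vl] vy.
    (* The predecessors of [a] are all of [l], so c = [A a] + [B a] c is its Bellman equation.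
       Vertices settled earlier keep their predecessors. *)
    rewrite -cats1 index_cat (negbTE al) /= eqxx addn0 take_size_cat //.
    rewrite (eq_first_open_mean (q' := q) (h' := H)) //.
    by have [_ <- _] := out a al vy; rewrite -cE; ring.
  rewrite H'E // -cats1 index_cat vl takel_cat ?index_size //.
  rewrite (inl v vl vy); congr (1 + _).
  rewrite -(inl v vl vy); apply: eq_first_open_mean => // u /mem_take ul.
  by rewrite H'E.
Qed.

(** If [y] is unsettled, it is eligible itself. Otherwise a path from [y] to an unsettled vertex
    leaves [l] along an edge of positive probability, whose factor makes the product [B] smaller
    than 1. *)
Lemma dijkstra_eligible l H A B : dijkstra_inv l H A B -> (size l < n)%N ->
  (forall u v, connect (fun a b => 0 < q [set a; b]%SET) u v) ->
  exists v, eligible H B v.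
Proof.
case=> -[Ul pw] memH out yP inl ln conn; rewrite /eligible.
move: yP; case: (boolP (y \in l)) => yl; last first.
  by move=> [_ _ By]; exists y; rewrite ltNge -memH yl By ltr01.
move=> _.
have [v vl] : exists v, v \notin l.
  apply/existsP; rewrite -negb_forall; apply: contraL ln => /forallP all_l.
  rewrite -leqNgt -[X in (X <= _)%N]card_ord -(card_uniqP Ul) subset_leq_card //.
  by apply/fintype.subsetP => v _; exact: all_l.
have [a [b [al bl qab]]] : exists a b, [/\ a \in l, b \notin l & 0 < q [set a; b]%SET].
  have /connectP[s + vE] := conn y v.
  elim: s y yl vE => [|z s IHs] x xl /= vE; first by rewrite vE xl in vl.
  case/andP=> xz pth; have [zl|zl] := boolP (z \in l); first exact: (IHs z).
  by exists x, z.
exists b; rewrite ltNge -memH bl /=.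
have [|-> _ _] := out b bl; first by apply: contraNneq bl => ->.
rewrite (big_rem a al) /= finset.setUC.
have /andP[r0 r1] := prod_closed01 b (rem a l).
apply: le_lt_trans (_ : 1 - q [set a; b]%SET < 1); last by rewrite gtrBl.
by rewrite ler_piMr // subr_ge0; case/andP: (q01 [set a; b]%SET).
Qed.

Lemma dijkstra_potential l H A B : dijkstra_inv l H A B -> size l = n ->
  potential q H y l.
Proof.
case=> -[Ul pw] memH _ yP inl ln.
have al v : v \in l.
  suff : l =i predT by move=> ->.
  by apply/subset_cardP; rewrite ?(card_uniqP Ul) ?card_ord //; apply/fintype.subsetP.
split=> //; first by split=> [|v]; [move: yP; rewrite al|rewrite -memH].
by move=> v vy; apply: inl.
Qed.

End Dijkstra.

(** * The program *)

Section TimedTriples.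
Variables (R : realType) (N : nat).
Implicit Types (s : state R) (Q : state R -> Prop).

(** A total-correctness triple: it includes halting without fault within time [t]. *)
Definition ends c s t Q :=
  exists t' s', [/\ exec N c s t' s', (t' <= t)%N & Q s'].

Lemma ends_do i s t Q :
  (if step N i s is Some s' then Q s' else False) -> ends (Do i) s t.+1 Q.
Proof.
case E: (step N i s) => [s'|//] Qs.
by exists 1%N, s'; split=> //; constructor.
Qed.

Lemma ends_seq c1 c2 s t1 t2 Q :
  ends c1 s t1 (fun s1 => ends c2 s1 t2 Q) -> ends (Seq c1 c2) s (t1 + t2) Q.
Proof.
move=> [t1' [s1 [e1 le1 [t2' [s2 [e2 le2 Qs]]]]]].
by exists (t1' + t2')%N, s2; split=> //; [econstructor; eauto|exact: leq_add].
Qed.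

Lemma ends_cons i c s t Q :
  (if step N i s is Some s' then ends c s' t Q else False) ->
  ends (Seq (Do i) c) s t.+1 Q.
Proof. by move=> H; rewrite -add1n; apply/ends_seq/ends_do. Qed.

Lemma ends_if b c1 c2 s t Q :
  ends (if holds b s then c1 else c2) s t Q -> ends (If b c1 c2) s t.+1 Q.
Proof. by move=> [t' [s' [e le Qs]]]; exists t'.+1, s'; split=> //; constructor. Qed.

Lemma ends_le c s t t' Q : (t <= t')%N -> ends c s t Q -> ends c s t' Q.
Proof.
by move=> tt [u [s' [e le Qs]]]; exists u, s'; split=> //; exact: leq_trans le tt.
Qed.

Lemma ends_imp c s t Q Q' : ends c s t Q -> (forall s', Q s' -> Q' s') ->
  ends c s t Q'.
Proof. by move=> [t' [s' [e le Qs]]] QQ; exists t', s'; split=> //; exact: QQ. Qed.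

(* Integer registers 0 and 2 hold the bound [n] and the constant 1. *)
Definition for_loop x body : cmd :=
  Seq (Do (ISet x 0))
    (While (ILt x 0) (Seq body (Do (IAdd x x 2)))).

Lemma ends_for n x body (I : nat -> state R -> Prop) t s Q :
  (n < N)%N ->
  (forall k s, I k s -> ireg s 0 = n /\ ireg s 2 = 1%N) ->
  (forall k j s, I k s -> I k (State [eta ireg s with x |-> j] (rreg s) (cell s))) ->
  (forall (v : 'I_n) s, I v s -> ireg s x = v ->
     ends body s t (fun s' => I v.+1 s' /\ ireg s' x = v)) ->
  I 0%N s -> (forall s', I n s' -> Q s') ->
  ends (for_loop x body) s (n * (t + 2) + 2) Q.
Proof.
move=> nN Ireg Iset Ibody I0 IQ.
suff loop m k s' : (k + m)%N = n -> I k s' -> ireg s' x = k ->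
    ends (While (ILt x 0) (Seq body (Do (IAdd x x 2)))) s' (m * (t + 2) + 1) (I n).
  rewrite (addn2 (n * _)); apply: ends_cons; rewrite /= /set_ireg (leq_ltn_trans _ nN) //.
  rewrite -(addn1 (n * _)).
  have [|u [s' [e le Is]]] := loop n 0%N _ (add0n n) (Iset 0%N 0%N s I0).
    by rewrite /= eqxx.
  by exists u, s'; split; [exact: e|exact: le|exact: IQ].
elim: m k s' => [|m IHm] k s' km Ik xk.
  exists 1%N, s'; split=> //; last by rewrite addn0 in km; rewrite -km.
  by apply: exec_while_end; rewrite /= xk (Ireg _ _ Ik).1 -km addn0 ltnn.
have kn : (k < n)%N by lia.
have [u [s1 [e1 le1 [I1 x1]]]] := Ibody (Ordinal kn) s' Ik xk.
have [n1 one1] := Ireg _ _ I1.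
pose s2 := State [eta ireg s1 with x |-> k.+1] (rreg s1) (cell s1).
have [||w [s3 [e3 le3 Q3]]] := IHm k.+1 s2 _ (Iset _ _ _ I1).
- by lia.
- by rewrite /= eqxx.
exists (u + 1 + w).+1, s3; split=> //; last by lia.
apply: (exec_while_loop (s1 := s2)) => //.
  by rewrite /= xk (Ireg _ _ Ik).1.
apply: (exec_seq e1); constructor; rewrite /= x1 one1 /set_ireg /= addn1.
by rewrite (leq_ltn_trans kn nN).
Qed.

End TimedTriples.

(* Integer registers: 0 n, 1 y, 2 the constant 1, 3/4/5 base addresses of the
   arrays H, A, B, 6 outer and 7 inner loop counter, 8 best vertex so far,
   9 address.  Real registers: 0 and 1 the constants 0 and 1, 2 value of the
   best candidate (-1 if there is none), 3 to 6 scratch. *)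
Infix ";;" := Seq (at level 61, right associativity).

Definition init_vertex : cmd :=
  Do (IAdd 9 3 7) ;; Do (Write 9 3) ;; Do (IAdd 9 4 7) ;; Do (Write 9 1) ;;
  Do (IAdd 9 5 7) ;; Do (Write 9 1).

(** Constants are natural numbers, so -1 is computed as 0 - 1. The last writes give [y] its special
    entries. *)
Definition init_arrays : cmd :=
  Do (ISet 2 1) ;; Do (IMul 3 0 0) ;; Do (IAdd 4 3 0) ;; Do (IAdd 5 4 0) ;;
  Do (RSet 0 0) ;; Do (RSet 1 1) ;; Do (RSub 3 0 1) ;;
  for_loop 7 init_vertex ;;
  Do (IAdd 9 4 1) ;; Do (Write 9 0) ;; Do (IAdd 9 5 1) ;; Do (Write 9 0).

(** A neutral instruction: real register 0 already holds 0. *)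
Definition skip : cmd := Do (RSet 0 0).

(** Multiplication by 1 replaces a copy instruction. *)
Definition take_candidate : cmd := Do (IMul 8 7 2) ;; Do (RMul 2 3 1).

(** The two outer tests are [eligible]; the two inner ones form a disjunction: no candidate so far,
    or a smaller one. *)
Definition scan_vertex : cmd :=
  Do (IAdd 9 3 7) ;; Do (Read 3 9) ;;
  If (RLt 3 0)
    (Do (IAdd 9 5 7) ;; Do (Read 3 9) ;;
     If (RLt 3 1)
       (Do (RSub 3 1 3) ;; Do (IAdd 9 4 7) ;; Do (Read 4 9) ;;
        Do (RDiv 3 4 3) ;;
        If (RLt 2 0) take_candidate (If (RLt 3 2) take_candidate skip))
       skip)
    skip.

(** Settled vertices are updated as well, harmlessly, since the invariant constrains [A] and [B] on
    unsettled ones only. Register 5 keeps [B] q from before the update of [B]. *)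
Definition relax_vertex : cmd :=
  Do (IMul 9 7 0) ;; Do (IAdd 9 9 8) ;; Do (Read 3 9) ;;
  Do (IAdd 9 5 7) ;; Do (Read 4 9) ;; Do (RMul 5 4 3) ;; Do (RSub 6 4 5) ;;
  Do (Write 9 6) ;;
  Do (RMul 5 5 2) ;; Do (IAdd 9 4 7) ;; Do (Read 4 9) ;; Do (RAdd 4 4 5) ;;
  Do (Write 9 4).

Definition finish_vertex : cmd :=
  Do (RSub 2 0 1) ;; for_loop 7 scan_vertex ;;
  Do (IAdd 9 3 8) ;; Do (Write 9 2) ;; for_loop 7 relax_vertex.

Definition best_policy_program : cmd :=
  init_arrays ;; for_loop 6 finish_vertex.

(** * Correctness and running time of the program *)

Section Correctness.
Variables (R : realType) (n N : nat) (q : vedge n -> R) (y : 'I_n).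
Hypothesis q01 : forall e, 0 <= q e <= 1.
Hypothesis NE : (5 * n ^ 2 <= N)%N.
Implicit Types (s : state R) (H A B : 'I_n -> R) (f : nat -> nat)
  (g c : nat -> R).

Let n0 : (0 < n)%N. Proof. by case: y => ? /=; lia. Qed.

(** Room for the matrix and the three arrays; 4 n is at most 4 n^2 because [y] makes [n]
    positive. *)
Let N_ge : (n * n + n + n + n + n <= N)%N.
Proof. by apply: leq_trans NE; rewrite -mulnn; nia. Qed.

Let matrix_lt (u v : 'I_n) : (u * n + v < n * n)%N.
Proof. by have := ltn_ord u; have := ltn_ord v; nia. Qed.

Definition registers f := [/\ f 0%N = n, f 1%N = y & f 2%N = 1%N] /\
  [/\ f 3%N = (n * n)%N, f 4%N = (n * n + n)%N & f 5%N = (n * n + n + n)%N].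

Definition constants g := g 0%N = 0 /\ g 1%N = 1.

(** The array of [H] lies on the output cells, so the result needs no copying. *)
Definition memory c H A B :=
  [/\ forall u v : 'I_n, c (u * n + v)%N = q [set u; v]%SET,
      forall v : 'I_n, c (n * n + v)%N = H v,
      forall v : 'I_n, c (n * n + n + v)%N = A v
    & forall v : 'I_n, c (n * n + n + n + v)%N = B v].

Lemma memory_ext c H A B H' A' B' : memory c H A B ->
  H =1 H' -> A =1 A' -> B =1 B' -> memory c H' A' B'.
Proof. by case=> *; split=> // *; congruence. Qed.

Let addr1 k (u v : 'I_n) : (k + u == k + v)%N = (u == v).
Proof. by rewrite eqn_add2l. Qed.

Lemma memory_setH c H A B (v : 'I_n) r : memory c H A B ->
  memory [eta c with (n * n + v)%N |-> r] [eta H with v |-> r] A B.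
Proof.
have lv := ltn_ord v.
case=> cM cH cA cB; split=> [u w|w|w|w] /=.
- by rewrite ifN_eq ?cM //; have := matrix_lt u w; lia.
- by rewrite addr1 cH.
- by rewrite ifN_eq ?cA //; have := ltn_ord w; lia.
- by rewrite ifN_eq ?cB //; have := ltn_ord w; lia.
Qed.

Lemma memory_setA c H A B (v : 'I_n) r : memory c H A B ->
  memory [eta c with (n * n + n + v)%N |-> r] H [eta A with v |-> r] B.
Proof.
have lv := ltn_ord v.
case=> cM cH cA cB; split=> [u w|w|w|w] /=.
- by rewrite ifN_eq ?cM //; have := matrix_lt u w; lia.
- by rewrite ifN_eq ?cH //; have := ltn_ord w; lia.
- by rewrite addr1 cA.
- by rewrite ifN_eq ?cB //; have := ltn_ord w; lia.
Qed.

Lemma memory_setB c H A B (v : 'I_n) r : memory c H A B ->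
  memory [eta c with (n * n + n + n + v)%N |-> r] H A [eta B with v |-> r].
Proof.
have lv := ltn_ord v.
case=> cM cH cA cB; split=> [u w|w|w|w] /=.
- by rewrite ifN_eq ?cM //; have := matrix_lt u w; lia.
- by rewrite ifN_eq ?cH //; have := ltn_ord w; lia.
- by rewrite ifN_eq ?cA //; have := ltn_ord w; lia.
- by rewrite addr1 cB.
Qed.

Lemma registers_set f x k : (5 < x)%N -> registers f ->
  registers [eta f with x |-> k].
Proof. by move=> x5 [[? ? ?] [? ? ?]]; do 2 split; rewrite /= ifN_eq //; lia. Qed.

(** The sign of [b] tells whether an eligible vertex has been seen; until then [arg] is
    arbitrary. *)
Definition scanned H A B k b arg :=
  if b < 0 then forall v : 'I_n, (v < k)%N -> ~~ eligible H B v
  else exists a : 'I_n, [/\ arg = a :> nat, eligible H B a, b = candidate A B a &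
    forall v : 'I_n, (v < k)%N -> eligible H B v -> b <= candidate A B v].

Lemma scanned_skip H A B (v : 'I_n) b arg : scanned H A B v b arg ->
  (eligible H B v -> 0 <= b <= candidate A B v) ->
  scanned H A B v.+1 b arg.
Proof.
rewrite /scanned; case: ifP => b0 sc ev.
  move=> u; rewrite ltnS leq_eqVlt => /orP[/eqP/val_inj ->|/sc //].
  by apply/negP => /ev; rewrite leNgt b0.
case: sc => a [aE ea bE bmin]; exists a; split=> // u.
rewrite ltnS leq_eqVlt => /orP[/eqP/val_inj ->|/bmin //].
by move=> /ev/andP[].
Qed.

Lemma scanned_take H A B (v : 'I_n) b arg : scanned H A B v b arg ->
  eligible H B v -> 0 <= candidate A B v -> (b < 0) || (candidate A B v < b) ->
  scanned H A B v.+1 (candidate A B v) v.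
Proof.
rewrite /scanned => sc ev c0 bc; rewrite ltNge c0 /=.
exists v; split=> // u; rewrite ltnS leq_eqVlt => /orP[/eqP/val_inj -> //|uv] eu.
case: ifP sc bc => [b0 sc _|b0 [a [_ _ _ bmin]] /= cb].
  by have := sc u uv; rewrite eu.
by apply: le_trans (ltW cb) (bmin u uv eu).
Qed.

(** The longest branch takes 14 time units; 20 is a round bound that also covers [relax_vertex]. *)
Lemma ends_scan s H A B (v : 'I_n) k :
  registers (ireg s) -> constants (rreg s) -> memory (cell s) H A B ->
  (forall v, eligible H B v -> 0 <= candidate A B v) ->
  scanned H A B v (rreg s 2%N) (ireg s 8%N) -> ireg s 6%N = k ->
  ireg s 7%N = v ->
  ends N scan_vertex s 20 (fun s' =>
    [/\ registers (ireg s'), constants (rreg s'), memory (cell s') H A B,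
        scanned H A B v.+1 (rreg s' 2%N) (ireg s' 8%N) & ireg s' 6%N = k] /\
    ireg s' 7%N = v).
Proof.
move=> rs cs ms c0 sc k6 v7; have lv := ltn_ord v.
case: (rs) (cs) (ms) => -[r0 r1 r2] [r3 r4 r5] [g0 g1] [cM cH cA cB].
apply: ends_cons; rewrite /= /set_ireg r3 v7 ifT; last by lia.
apply: ends_cons; rewrite /= ifT; last by lia.
rewrite cH; apply: ends_if; rewrite /= g0.
have skipP s' : (eligible H B v -> 0 <= rreg s 2%N <= candidate A B v) ->
    registers (ireg s') -> constants (rreg s') -> cell s' = cell s ->
    ireg s' 6%N = k -> ireg s' 7%N = v -> ireg s' 8%N = ireg s 8%N ->
    rreg s' 2%N = rreg s 2%N ->
    ends N skip s' 1 (fun s' =>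
    [/\ registers (ireg s'), constants (rreg s'), memory (cell s') H A B,
        scanned H A B v.+1 (rreg s' 2%N) (ireg s' 8%N) & ireg s' 6%N = k] /\
    ireg s' 7%N = v).
  move=> ev rs' cs' cE k6' v7' a8 b2; apply: ends_do; rewrite /= cE a8 b2.
  by split=> //; split=> //; [case: cs'; split|exact: scanned_skip].
case: ifP => Hv; last first.
  apply: (@ends_le _ _ _ _ 1) => //; apply: skipP => //=.
  by rewrite /eligible Hv.
apply: ends_cons; rewrite /= /set_ireg /= r5 v7 ifT; last by lia.
apply: ends_cons; rewrite /= ifT; last by lia.
rewrite cB; apply: ends_if; rewrite /= g1.
case: ifP => Bv; last first.
  apply: (@ends_le _ _ _ _ 1) => //; apply: skipP => //=.
  by rewrite /eligible Bv andbF.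
have ev : eligible H B v by rewrite /eligible Hv Bv.
apply: ends_cons; rewrite /= g1.
apply: ends_cons; rewrite /= /set_ireg /= r4 v7 ifT; last by lia.
apply: ends_cons; rewrite /= ifT; last by lia.
apply: ends_cons; rewrite /= subr_eq0 gt_eqF // cA -/(candidate A B v).
have takeP s' : (rreg s 2%N < 0) || (candidate A B v < rreg s 2%N) ->
    registers (ireg s') -> constants (rreg s') -> cell s' = cell s ->
    ireg s' 6%N = k -> ireg s' 7%N = v -> rreg s' 3%N = candidate A B v ->
    ends N take_candidate s' 2 (fun s' =>
    [/\ registers (ireg s'), constants (rreg s'), memory (cell s') H A B,
        scanned H A B v.+1 (rreg s' 2%N) (ireg s' 8%N) & ireg s' 6%N = k] /\
    ireg s' 7%N = v).
  move=> bv rs' cs' cE k6' v7' b3.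
  case: (rs') (cs') => -[_ _ one] _ [g0' g1'].
  apply: ends_cons; rewrite /= /set_ireg /= v7' one muln1 ifT; last by lia.
  apply: ends_do; rewrite /= b3 g1' mulr1 cE; split=> //; split=> //.
  by apply: scanned_take sc ev (c0 v ev) bv.
apply: ends_if; rewrite /= g0; case: ifP => b0.
  by apply: (@ends_le _ _ _ _ 2) => //; apply: takeP => //=; rewrite b0.
apply: ends_if; rewrite /=; case: ifP => cb.
  apply: (@ends_le _ _ _ _ 2) => //; apply: takeP => //=; by rewrite cb orbT.
apply: (@ends_le _ _ _ _ 1) => //; apply: skipP => //=.
by move=> _; rewrite leNgt b0 leNgt cb.
Qed.

Lemma ends_relax s H A B (v a : 'I_n) x k :
  registers (ireg s) -> constants (rreg s) -> memory (cell s) H A B ->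
  rreg s 2%N = x -> ireg s 8%N = a -> ireg s 6%N = k -> ireg s 7%N = v ->
  ends N relax_vertex s 20 (fun s' =>
    [/\ registers (ireg s'), constants (rreg s'),
        memory (cell s') H
          [eta A with v |-> A v + B v * q [set v; a]%SET * x]
          [eta B with v |-> B v - B v * q [set v; a]%SET]
      & [/\ rreg s' 2%N = x, ireg s' 8%N = a & ireg s' 6%N = k]] /\
    ireg s' 7%N = v).
Proof.
move=> rs cs ms x2 a8 k6 v7; have lv := ltn_ord v; have lva := matrix_lt v a.
case: (rs) (cs) (ms) => -[r0 r1 r2] [r3 r4 r5] [g0 g1] [cM cH cA cB].
apply: ends_cons; rewrite /= /set_ireg v7 r0 ifT; last by lia.
apply: ends_cons; rewrite /= /set_ireg /= a8 ifT; last by lia.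
apply: ends_cons; rewrite /= ifT ?cM; last by lia.
apply: ends_cons; rewrite /= /set_ireg /= r5 v7 ifT; last by lia.
apply: ends_cons; rewrite /= ifT ?cB; last by lia.
apply: ends_cons => /=.
apply: ends_cons => /=.
apply: ends_cons; rewrite /= ifT; last by lia.
apply: ends_cons => /=.
apply: ends_cons; rewrite /= /set_ireg /= r4 v7 ifT; last by lia.
apply: ends_cons; rewrite /= ifT; last by lia.
apply: ends_cons => /=.
apply: ends_do; rewrite /= ifT; last by lia.
split=> //=; split=> //.
have neq : (n * n + n + v == n * n + n + n + v)%N = false by lia.
rewrite neq cA x2.
exact: memory_setA (memory_setB _ _ ms).
Qed.


Hypothesis conn :
  forall u v : 'I_n, connect (fun a b => 0 < q [set a; b]%SET) u v.

Lemma ends_finish s l H A B k :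
  registers (ireg s) -> constants (rreg s) -> memory (cell s) H A B ->
  dijkstra_inv q y l H A B -> size l = k -> (k < n)%N -> ireg s 6%N = k ->
  ends N finish_vertex s (44 * n + 7) (fun s' =>
    [/\ registers (ireg s'), constants (rreg s'), ireg s' 6%N = k
      & exists l' H' A' B', [/\ size l' = k.+1, dijkstra_inv q y l' H' A' B'
          & memory (cell s') H' A' B']]).
Proof.
move=> rs cs ms inv lk kn k6; have nN : (n < N)%N by nia.
(* Two loops of 22 n + 2 units and three single instructions. *)
have -> : (44 * n + 7 = ((n * (20 + 2) + 2) + ((n * (20 + 2) + 2)).+2).+1)%N by lia.
apply: ends_cons => /=; case: (cs) => g0 g1; rewrite g0 g1 sub0r.
apply: ends_seq.
pose I j s' := [/\ registers (ireg s'), constants (rreg s'),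
  memory (cell s') H A B, scanned H A B j (rreg s' 2%N) (ireg s' 8%N)
  & ireg s' 6%N = k].
apply: (ends_for nN (I := I)); rewrite /I.
- by move=> j s' [[[-> _ ->]]].
- by move=> j i s' [rs' cs' ms' sc k6']; split=> //; exact: registers_set.
- move=> v s' [rs' cs' ms' sc k6'] v7'; apply: ends_scan => // u.
  exact: (dijkstra_candidate_ge0 q01 inv).
- by split=> //=; rewrite /scanned ltrN10.
move=> {rs cs ms g0 g1 k6} s1 [rs cs ms].
(* A scan without a candidate would contradict connectivity, as some vertex is still unsettled. *)
rewrite /scanned; case: ifP => [_ none _|_ [a [a8 ea xE amin]] k6].
  have [||v ev] := dijkstra_eligible q01 inv; rewrite ?lk //.
  by have := none v (ltn_ord v); rewrite ev.
have la := ltn_ord a; case: (rs) => -[r0 r1 r2] [r3 r4 r5].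
apply: ends_cons; rewrite /= /set_ireg r3 a8 ifT; last by lia.
apply: ends_cons; rewrite /= ifT; last by lia.
set x := rreg s1 2%N in xE amin *.
pose H' := [eta H with a |-> x].
pose A' v := A v + B v * q [set v; a]%SET * x.
pose B' v := B v - B v * q [set v; a]%SET.
(* An array in the middle of the loop: new entries below [j], old ones from [j] on. *)
pose upto j (F F' : 'I_n -> R) (v : 'I_n) := if (v < j)%N then F' v else F v.
pose I' j s' := [/\ registers (ireg s'), constants (rreg s'),
  memory (cell s') H' (upto j A A') (upto j B B')
  & [/\ rreg s' 2%N = x, ireg s' 8%N = a & ireg s' 6%N = k]].
have uptoS F F' (v : 'I_n) : [eta upto v F F' with v |-> F' v] =1 upto v.+1 F F'.
  move=> u; rewrite /upto /= ltnS; case: eqP => [->|uv]; first by rewrite leqnn.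
  have /negbTE uv' : (u : nat) != v by apply/eqP => /ord_inj.
  by rewrite [in RHS]leq_eqVlt uv'.
apply: (ends_for nN (I := I')); rewrite /I'.
- by move=> j s' [[[-> _ ->]]].
- by move=> j i s' [rs' cs' ms' [x2 a8' k6']]; split=> //; exact: registers_set.
- move=> v s' [rs' cs' ms' [x2 a8' k6']] v7'.
  apply: ends_imp (ends_relax rs' cs' ms' x2 a8' k6' v7') _ => s2.
  move=> [[rs2 cs2 ms2 e2] v72]; split=> //; split=> //.
  by apply: memory_ext ms2 _ _ _ => //= u;
    rewrite -uptoS /= {1 2}/upto ltnn.
- split=> //=.
  by apply: (memory_ext (memory_setH a x ms)) => // u; rewrite /upto ltn0.
move=> s2 [rs2 cs2 ms2 [_ _ k62]]; split=> //.
exists (rcons l a), H', A', B'; split; first by rewrite size_rcons lk.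
  by rewrite /H' /A' /B' xE; apply: dijkstra_step => // v; rewrite -xE; exact: amin.
by apply: memory_ext ms2 _ _ _ => // u; rewrite /upto ltn_ord.
Qed.

Lemma ends_init s : ireg s 0%N = n -> ireg s 1%N = y ->
  (forall u v : 'I_n, cell s (u * n + v)%N = q [set u; v]%SET) ->
  ends N init_arrays s (8 * n + 13) (fun s' =>
    [/\ registers (ireg s'), constants (rreg s')
      & memory (cell s') (fun=> -1) (fun v => if v == y then 0 else 1)
          (fun v => if v == y then 0 else 1)]).
Proof.
move=> r0 r1 cM; have nN : (n < N)%N by nia.
have ly := ltn_ord y.
have -> : (8 * n + 13 = ((n * (6 + 2) + 2) + 4).+4.+3)%N by lia.
apply: ends_cons; rewrite /= /set_ireg ifT; last by lia.
apply: ends_cons; rewrite /= /set_ireg /= r0 ifT; last by lia.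
apply: ends_cons; rewrite /= /set_ireg /= r0 ifT; last by lia.
apply: ends_cons; rewrite /= /set_ireg /= r0 ifT; last by lia.
apply: ends_cons => /=; apply: ends_cons => /=; apply: ends_cons => /=.
rewrite sub0r; apply: ends_seq.
(* The cells not yet initialised hold arbitrary values, so they are described by the starting
   state. *)
pose upto j r k v := if (v < j)%N then r else cell s (k + v)%N.
pose I j s' := [/\ registers (ireg s'), constants (rreg s'), rreg s' 3%N = -1
  & memory (cell s') (fun v => upto j (-1) (n * n)%N v)
     (fun v => upto j 1 (n * n + n)%N v) (fun v => upto j 1 (n * n + n + n)%N v)].
have uptoS r k (v : 'I_n) :
    [eta (fun u : 'I_n => upto v r k u) with v |-> r] =1 (fun u => upto v.+1 r k u).
  move=> u; rewrite /upto /= ltnS; case: eqP => [->|uv]; first by rewrite leqnn.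
  have /negbTE uv' : (u : nat) != v by apply/eqP => /ord_inj.
  by rewrite [in RHS]leq_eqVlt uv'.
apply: (ends_for nN (I := I)); rewrite /I.
- by move=> j s' [[[-> _ ->]]].
- by move=> j i s' [rs' cs' x3 ms']; split=> //; exact: registers_set.
- move=> v s' [rs cs x3 ms] v7; have lv := ltn_ord v.
  case: (rs) (cs) => -[_ _ _] [r3 r4 r5] [g0 g1].
  apply: ends_cons; rewrite /= /set_ireg r3 v7 ifT; last by lia.
  apply: ends_cons; rewrite /= ifT; last by lia.
  apply: ends_cons; rewrite /= /set_ireg /= r4 v7 ifT; last by lia.
  apply: ends_cons; rewrite /= ifT; last by lia.
  apply: ends_cons; rewrite /= /set_ireg /= r5 v7 ifT; last by lia.
  apply: ends_do; rewrite /= ifT; last by lia.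
  split=> //=; split=> //; rewrite x3 g1.
  have := memory_setB v 1 (memory_setA v 1 (memory_setH v (-1) ms)).
  by move/memory_ext; apply=> u; exact: uptoS.
- by split=> //; split=> // v; rewrite /upto ltn0.
move=> s1 [rs cs _ ms]; case: (rs) (cs) => -[_ r1' _] [r3 r4 r5] [g0 g1].
apply: ends_cons; rewrite /= /set_ireg r4 r1' ifT; last by lia.
apply: ends_cons; rewrite /= ifT; last by lia.
apply: ends_cons; rewrite /= /set_ireg /= r5 r1' ifT; last by lia.
apply: ends_do; rewrite /= ifT; last by lia.
split=> //=; rewrite g0.
have := memory_setB y 0 (memory_setA y 0 ms).
by move/memory_ext; apply=> u /=; rewrite /upto ltn_ord.
Qed.

Lemma ends_program s : ireg s 0%N = n -> ireg s 1%N = y ->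
  (forall u v : 'I_n, cell s (u * n + v)%N = q [set u; v]%SET) ->
  ends N best_policy_program s (100 * n ^ 2) (fun s' =>
    exists l, potential q (output s') y l).
Proof.
move=> r0 r1 cM; have nN : (n < N)%N by nia.
(* The total 44 n^2 + 17 n + 15 is at most 76 n^2 for positive [n]. *)
apply: (@ends_le _ _ _ _ (8 * n + 13 + (n * (44 * n + 7 + 2) + 2))).
  by rewrite -mulnn; nia.
apply: ends_seq; apply: ends_imp (ends_init r0 r1 cM) _ => s1 [rs cs ms].
pose I k s' := [/\ registers (ireg s'), constants (rreg s')
  & exists l H A B, [/\ size l = k, dijkstra_inv q y l H A B
      & memory (cell s') H A B]].
apply: (ends_for nN (I := I)); rewrite /I.
- by move=> j s' [[[-> _ ->]]].
- by move=> j i s' [rs' cs' ms']; split=> //; exact: registers_set.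
- move=> v s' [rs' cs' [l [H [A [B [lv inv ms']]]]]] v6.
  apply: ends_imp (ends_finish rs' cs' ms' inv lv (ltn_ord v) v6) _ => s2.
  by case.
- split=> //; exists [::], (fun=> -1), (fun v => if v == y then 0 else 1),
    (fun v => if v == y then 0 else 1).
  by split=> //; exact: dijkstra_init.
move=> s2 [_ _ [l [H [A [B [ln inv [_ cH _ _]]]]]]]; exists l.
have -> : output s2 = H by apply: funext => v; exact: cH.
exact: dijkstra_potential inv ln.
Qed.

End Correctness.

Theorem theorem8 (R : realType) :
  exists (prog : cmd) (C : nat),
    forall (n : nat) (E : snapshot n) (p : vedge n -> R) (y : 'I_n),
      simple_graph E -> edge_probabilities E p -> support_connected E p ->
    forall s : state R, encodes_input E p y s ->
    exists (t : nat) (s' : state R),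
      exec (C * n ^ 2)%N prog s t s' /\
      (t <= C * n ^ 2)%N /\
      forall (d : measure_display) (T : measurableType d)
        (P : probability T R) (G : nat -> T -> snapshot n),
        memoryless P E p G ->
        forall v : 'I_n, best_policy_value P G v y (output s' v).
Proof.
(* The constant 100 bounds the time and also fixes the memory size, of which 5 n^2 cells suffice. *)
exists best_policy_program, 100%N => n E p y _ p01 conn s [r0 r1 cM].
have NE : (5 * n ^ 2 <= 100 * n ^ 2)%N by rewrite leq_mul2r orbT.
have conn' u v : connect (fun a b => 0 < edge_prob E p [set a; b]%SET) u v.
  rewrite (eq_connect (e' := fun a b => ([set a; b]%SET \in E) &&
    (0 < p [set a; b]%SET))) // => a b.
  by rewrite /edge_prob; case: ifP; rewrite ?ltxx.
have [t [s' [ex le [l pot]]]] :=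
  ends_program (edge_prob01 p01) NE conn' r0 r1 cM.
exists t, s'; split=> //; split=> // d T P G GP.
exact: (potential_best_policy p01 GP pot).
Qed.
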